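(* Fix $\kappa>0$. Let $\bar X_1,\bar X_3\in\mathbb{R}$ satisfy $\bar X_1=\kappa+\tfrac14\bar X_3^2$ with $\bar X_3^2>8\kappa$, and let $$\mathcal{W}(\bar X_3)=\{(A,B)\in\mathcal{D}:X_1(A,B)=\bar X_1,\ X_3(A,B)=\bar X_3,\ X_2(A,B)=0\}.$$ Then the set $$\mathcal{R}(\bar X_3)=\{(A,B)\in\mathcal{W}(\bar X_3):A\in\mathrm{SO}(2,\mathbb{R})\}$$ corresponds to the orbit of the rigid rotation $U(\tfrac12\bar X_3t)$, i.e. it is the set of points $\big(A(t),\dot A(t)\big)$, $t\in\mathbb{R}$, for the solution $A(t)=U(\tfrac12\bar X_3t)$ of $$\ddot A(t)+\kappa A(t)=\lambda(t)\,\mathrm{cof}\,A(t).\tag{E}$$ The set $\mathcal{W}(\bar X_3)\setminus\mathcal{R}(\bar X_3)$ is a stable and unstable manifold for $\mathcal{R}(\bar X_3)$. Every solution orbit $(A(t),\dot A(t))$ of (E) in $\mathcal{W}(\bar X_3)\setminus\mathcal{R}(\bar X_3)$ is homoclinic to $\mathcal{R}(\bar X_3)$, that is, $$\lim_{|t|\to\infty}e^{\mu|t|}\,\mathrm{dist}\left[(A(t),\dot A(t)),\mathcal{R}(\bar X_3)\right]=0$$ for some $\mu>0$.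
   Context: $\mathbb{M}^2$ is the space of real $2\times2$ matrices with inner product $\langle A,B\rangle=\mathrm{tr}(A^\top B)$ and norm $|A|=\langle A,A\rangle^{1/2}$. $\mathrm{SL}(2,\mathbb{R})=\{A:\det A=1\}$; $\mathrm{SO}(2,\mathbb{R})$ is the rotation group. $Z=\begin{bmatrix}0&-1\\1&0\end{bmatrix}$, $U(\theta)=\cos\theta\,I+\sin\theta\,Z$, and $\mathrm{cof}\,A=ZAZ^\top$ is the cofactor matrix. $\mathcal{D}=\{(A,B)\in\mathbb{M}^2\times\mathbb{M}^2:\det A=1,\ \langle B,\mathrm{cof}\,A\rangle=0\}$ is the tangent bundle of $\mathrm{SL}(2,\mathbb{R})$. $$X_1(A,B)=\tfrac12|B|^2+\tfrac{\kappa}{2}|A|^2,\quad X_2(A,B)=\tfrac12\langle ZA-AZ,B\rangle,\quad X_3(A,B)=\tfrac12\langle ZA+AZ,B\rangle.$$ Solutions of (E) are curves $A\in C^0(\mathbb{R},\mathrm{SL}(2,\mathbb{R}))\cap C^2(\mathbb{R},\mathbb{M}^2)$ for which the equation holds for some $\lambda\in C^0(\mathbb{R},\mathbb{R})$ (necessarily $\lambda(t)=2(\kappa-\det\dot A(t))/|A(t)|^2$). A rigid rotation is a solution with values in $\mathrm{SO}(2,\mathbb{R})$. $\mathrm{dist}$ is Euclidean distance in $\mathbb{M}^2\times\mathbb{M}^2$. ''Stable and unstable manifold'' means that orbits starting in the set remain in it and approach $\mathcal{R}(\bar X_3)$ both as $t\to\infty$ and as $t\to-\infty$. *)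

(* Defs.v *)
From HB Require Import structures.
From mathcomp Require Import all_boot all_order all_algebra.
From mathcomp Require Import all_classical all_reals all_analysis.

Set Implicit Arguments.
Unset Strict Implicit.
Unset Printing Implicit Defensive.

Import Order.TTheory GRing.Theory Num.Theory.
Import numFieldNormedType.Exports.

Local Open Scope classical_set_scope.
Local Open Scope ring_scope.

Section Defs.
Variable R : realType.
Implicit Types (A B : 'M[R]_2) (p q : 'M[R]_2 * 'M[R]_2).

Definition mxinner A B : R := \tr (A^T *m B).

(* The library norm `|A| on matrices is the sup norm, hence the separate
   Euclidean norm and distance. *)
Definition fnorm A : R := Num.sqrt (mxinner A A).

Definition edist p q : R :=
  Num.sqrt (fnorm (p.1 - q.1) ^+ 2 + fnorm (p.2 - q.2) ^+ 2).

(* Only meaningful for nonempty [S], since [inf set0 = 0]. *)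
Definition dist_to_set p (S : set ('M[R]_2 * 'M[R]_2)) : R :=
  inf [set edist p q | q in S].

Definition SL2 : set 'M[R]_2 := [set A | \det A = 1].

Definition SO2 : set 'M[R]_2 := [set A | A^T *m A = 1%:M /\ \det A = 1].

(* Z = [0, -1; 1, 0] *)
Definition Zmx : 'M[R]_2 := delta_mx 1 0 - delta_mx 0 1.

Definition Umx (theta : R) : 'M[R]_2 := cos theta *: 1%:M + sin theta *: Zmx.

Definition cof A : 'M[R]_2 := Zmx *m A *m Zmx^T.

Definition tangent_bundle : set ('M[R]_2 * 'M[R]_2) :=
  [set p | SL2 p.1 /\ mxinner p.2 (cof p.1) = 0].

Definition X1 (kappa : R) p : R :=
  2^-1 * fnorm p.2 ^+ 2 + kappa / 2 * fnorm p.1 ^+ 2.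

Definition X2 p : R := 2^-1 * mxinner (Zmx *m p.1 - p.1 *m Zmx) p.2.

Definition X3 p : R := 2^-1 * mxinner (Zmx *m p.1 + p.1 *m Zmx) p.2.

Definition C2 (A : R -> 'M[R]_2) : Prop :=
  [/\ forall t : R, derivable A t 1,
      forall t : R, derivable (derive1 A) t 1
    & continuous (derive1 (derive1 A))].

Definition is_solution (kappa : R) (A : R -> 'M[R]_2) : Prop :=
  [/\ continuous A, forall t, SL2 (A t), C2 A
    & exists2 lambda : R -> R, continuous lambda &
        forall t, derive1 (derive1 A) t + kappa *: A t = lambda t *: cof (A t)].

Definition is_rigid_rotation (kappa : R) (A : R -> 'M[R]_2) : Prop :=
  is_solution kappa A /\ forall t, SO2 (A t).

Definition phase (A : R -> 'M[R]_2) (t : R) : 'M[R]_2 * 'M[R]_2 :=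
  (A t, derive1 A t).

Definition Wset (kappa X1bar X3bar : R) : set ('M[R]_2 * 'M[R]_2) :=
  [set p | [/\ tangent_bundle p, X1 kappa p = X1bar, X3 p = X3bar
             & X2 p = 0]].

Definition Rset (kappa X1bar X3bar : R) : set ('M[R]_2 * 'M[R]_2) :=
  [set p | Wset kappa X1bar X3bar p /\ SO2 p.1].

Definition stable_unstable_manifold (kappa : R)
    (M S : set ('M[R]_2 * 'M[R]_2)) : Prop :=
  forall A : R -> 'M[R]_2, is_solution kappa A -> M (phase A 0) ->
    [/\ forall t, M (phase A t),
        dist_to_set (phase A t) S @[t --> +oo] --> (0 : R)
      & dist_to_set (phase A t) S @[t --> -oo] --> (0 : R)].

Definition homoclinic (A : R -> 'M[R]_2)
    (S : set ('M[R]_2 * 'M[R]_2)) : Prop :=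
  exists2 mu : R, 0 < mu &
    expR (mu * `|t|) * dist_to_set (phase A t) S @[t --> +oo] --> (0 : R) /\
    expR (mu * `|t|) * dist_to_set (phase A t) S @[t --> -oo] --> (0 : R).

End Defs.

(* Main.v *)
Require Import Defs.
From HB Require Import structures.
From mathcomp Require Import all_boot all_order all_algebra.
From mathcomp Require Import all_classical all_reals all_analysis.
From mathcomp Require Import ring lra.

Import Order.TTheory GRing.Theory Num.Theory.
Import numFieldNormedType.Exports.

Local Open Scope classical_set_scope.
Local Open Scope ring_scope.

(** Write a matrix as [A = p I + q Z + r K + s M] with [K = diag(1, -1)] and
    [M] the exchange matrix, and set [u = p + i q] (conformal part) and
    [v = r + i s] (anticonformal part).  Then [det A = |u|^2 - |v|^2], the
    cofactor map is [(u, v) |-> (u, - v)], and the equation of motion decouples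
    into [u'' = (lambda - kappa) u] and [v'' = - (lambda + kappa) v].  The
    quantities [X3 = 2 u x u'], [X2 = 2 v x v'] and [X1 = |u'|^2 + |v'|^2 +
    kappa (|u|^2 + |v|^2)] are conserved, and [A] is a rotation exactly when
    [v = 0].

    Put [sg = |v|^2], so that [|u|^2 = 1 + sg], and [c = X3^2 - 8 kappa > 0].
    With [X2 = 0] and [X1 = kappa + X3^2 / 4], Lagrange's identity turns the
    conservation laws into the first integral
    [sg'^2 (1 + 2 sg) = sg^2 (c - 8 kappa sg)] ([first_integral]).  Hence
    [|sg'| <= sqrt c * sg], and by Gronwall [sg] vanishes everywhere or nowhere
    ([sg_dichotomy]): an orbit off the rotations stays off them.

    On such an orbit the logarithmic derivative [y = sg' / sg] solves the Riccati
    equation [y' = - (c - y^2) / (2 (1 + 2 sg))] with [y^2 < c]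
    ([derive_logder]).  The ratio [(sqrt c + y) / (sqrt c - y)] then decays
    exponentially forwards in time, and its inverse backwards
    ([riccati_decay]); since [8 kappa sg <= c - y^2], [sg] decays exponentially
    at both ends ([sg_decay]).

    Finally, with [w = X3 / 2], the point of the rotation orbit with conformal
    part [u / |u|] is at squared distance at most [4 (1 + w^2) sg] from
    [(A, A')] ([dist_to_rotation_le]), because the energy identity bounds all
    velocity terms together.  Exponential decay of the distance follows. *)

(** * Calculus on the real line *)

Section calculus.
Local Set Implicit Arguments.
Local Unset Strict Implicit.
Variable R : realType.
Implicit Types (f g df dg : R -> R) (t : R).

(** This and the next lemmas restate the usual rules on eta-expanded functions,
    with products instead of scalings, so that the derivative of an explicit
    expression is a ring expression. *)
Lemma derD f g t a b : is_derive t 1 f a -> is_derive t 1 g b ->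
  is_derive t 1 (fun x => f x + g x) (a + b).
Proof. exact: is_deriveD. Qed.

Lemma derB f g t a b : is_derive t 1 f a -> is_derive t 1 g b ->
  is_derive t 1 (fun x => f x - g x) (a - b).
Proof. exact: is_deriveB. Qed.

Lemma derN f t a : is_derive t 1 f a -> is_derive t 1 (fun x => - f x) (- a).
Proof. exact: is_deriveN. Qed.

Lemma derM f g t a b : is_derive t 1 f a -> is_derive t 1 g b ->
  is_derive t 1 (fun x => f x * g x) (f t * b + g t * a).
Proof. exact: is_deriveM. Qed.

Lemma derC (k t : R) : is_derive t 1 (fun _ : R => k) 0.
Proof. exact: is_derive_cst. Qed.

Lemma derV f t a : f t != 0 -> is_derive t 1 f a ->
  is_derive t 1 (fun x => (f x)^-1) (- (f t) ^- 2 * a).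
Proof. exact: is_deriveV. Qed.

Lemma der_expR_lin (k t : R) :
  is_derive t 1 (fun x => expR (k * x)) (k * expR (k * t)).
Proof.
have h : is_derive t 1 (fun x : R => k * x) k.
  have := derM (derC k t) (is_derive_id t 1).
  by rewrite mulr1 mulr0 addr0.
rewrite mulrC.
exact: (@is_derive1_comp _ expR (fun x => k * x) _ _ _ (is_derive_expR _) h).
Qed.

Lemma der_rev f t a : is_derive (- t) 1 f a ->
  is_derive t 1 (fun x => f (- x)) (- a).
Proof.
move=> h; rewrite -mulrN1.
exact: (@is_derive1_comp _ f -%R _ _ _ h (is_deriveNid t 1)).
Qed.

Lemma derivative_continuous f df : (forall t, is_derive t 1 f (df t)) ->
  continuous f.
Proof.
by move=> h t; apply: differentiable_continuous; apply/derivable1_diffP; case: (h t).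
Qed.

Lemma derive_ge0_nondecreasing f df : (forall t, is_derive t 1 f (df t)) ->
  (forall t, 0 <= df t) -> {homo f : x y / x <= y}.
Proof.
move=> h h0 x y xy.
have cf : {within `[x, y], continuous f}.
  exact: continuous_subspaceT (derivative_continuous h).
have [z _ e] := MVT_segment xy (fun z _ => h z) cf.
by rewrite -subr_ge0 e mulr_ge0 // subr_ge0.
Qed.

Lemma derive_le0_nonincreasing f df : (forall t, is_derive t 1 f (df t)) ->
  (forall t, df t <= 0) -> {homo f : x y /~ x <= y}.
Proof.
move=> h h0 x y xy; rewrite -lerN2.
apply: (@derive_ge0_nondecreasing (fun x => - f x) (fun x => - df x)) xy => t.
(* the derivative of [- f] is found by instance resolution from [h] *)
by rewrite oppr_ge0.
Qed.

Lemma derive0_const f : (forall t, is_derive t 1 f 0) -> forall x y, f x = f y.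
Proof. by move=> h x y; apply: is_derive_0_is_cst. Qed.

(** A nonnegative function bounded by a multiple of [expR (- k |t|)] still tends
    to 0 at both ends after multiplication by [expR (m |t|)], when [m < k]. *)
Lemma cvg0_expR_bound f (C k m : R) : m < k ->
  (forall t, 0 <= f t) -> (forall t, f t <= C * expR (- k * `|t|)) ->
  expR (m * `|t|) * f t @[t --> +oo] --> (0 : R) /\
  expR (m * `|t|) * f t @[t --> -oo] --> (0 : R).
Proof.
move=> mk f0 fC.
wlog suff : f f0 fC / expR (m * `|t|) * f t @[t --> +oo] --> (0 : R).
  move=> h; split; first exact: h.
  apply/cvgNy_compNP; rewrite /comp.
  under eq_fun do rewrite normrN.
  by apply: (h (fun t => f (- t))) => // t; rewrite -(normrN t).
have C0 : 0 <= C.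
  by move: (fC 0); rewrite normr0 mulr0 expR0 mulr1; apply: le_trans.
have km : 0 < k - m by rewrite subr_gt0.
have lim : C * expR (- ((k - m) * t)) @[t --> +oo] --> (0 : R).
  rewrite -(mulr0 C); apply: cvgM; first exact: cvg_cst.
  apply: (cvg_comp (fun t => (k - m) * t) (fun t => expR (- t))).
    exact: gt0_cvgMry km cvg_id.
  exact: cvgr_expR.
apply: squeeze_cvgr (cvg_cst 0) lim.
near=> t.
have t0 : 0 <= t by near: t; exact: nbhs_pinfty_ge.
rewrite mulr_ge0 ?expR_ge0 //=.
apply: le_trans (ler_wpM2l (expR_ge0 _) (fC t)) _.
rewrite mulrCA -expRD ger0_norm // ler_wpM2l // ler_expR.
by rewrite le_eqVlt; apply/orP; left; apply/eqP; ring.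
Unshelve. all: end_near.
Qed.

End calculus.

(** * Exponential decay for a Riccati equation *)

Section riccati.
Local Set Implicit Arguments.
Local Unset Strict Implicit.
Variable R : realType.
Implicit Types (y K : R -> R) (s k t : R).

(** The ratio [h = (s + y) / (s - y)] satisfies [h' = - 2 s K h], and
    [s^2 - y^2 = (s - y)^2 h]. *)
Lemma riccati_decay_pos y K s k : 0 < k -> (forall t, k <= K t) ->
  (forall t, - s < y t < s) ->
  (forall t, is_derive t 1 y (- (s ^+ 2 - y t ^+ 2) * K t)) ->
  exists2 C, 0 <= C & forall t, 0 <= t ->
    s ^+ 2 - y t ^+ 2 <= C * expR (- (2 * s * k) * t).
Proof.
move=> k_gt0 kK ys yE.
have s0 : 0 < s by have /andP[? ?] := ys 0; lra.
have sy t : 0 < s - y t by have /andP[_ ?] := ys t; lra.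
have syD t : 0 < s + y t by have /andP[? _] := ys t; lra.
pose h t := (s + y t) / (s - y t).
have h0 t : 0 < h t by rewrite divr_gt0.
have hE t : is_derive t 1 h (- (2 * s * K t) * h t).
  have d1 := derD (derC s t) (yE t).
  have d2 := @derV _ (fun x => s - y x) t _ (lt0r_neq0 (sy t))
    (derB (derC s t) (yE t)).
  apply: is_derive_eq (derM d1 d2) _; rewrite /h.
  by field; rewrite lt0r_neq0.
pose m := 2 * s * k.
pose g t := h t * expR (m * t).
have gE t : is_derive t 1 g (2 * s * (k - K t) * g t).
  by apply: is_derive_eq (derM (hE t) (der_expR_lin m t)) _; rewrite /g /m; ring.
have gle t : 0 <= t -> g t <= g 0.
  move=> t0; apply: (derive_le0_nonincreasing gE) t0 => u.
  rewrite mulr_le0_ge0 //; last by rewrite mulr_ge0 ?expR_ge0 ?ltW.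
  by rewrite mulr_ge0_le0 ?subr_le0 //; lra.
exists (4 * s ^+ 2 * h 0).
  by apply: mulr_ge0 (ltW (h0 0)); rewrite mulr_ge0 ?sqr_ge0.
move=> t t0.
have -> : s ^+ 2 - y t ^+ 2 = (s - y t) ^+ 2 * h t.
  by rewrite /h; field; rewrite lt0r_neq0.
have hle : h t <= h 0 * expR (- m * t).
  move: (gle t t0); rewrite /g mulr0 expR0 mulr1 => {}gle.
  by rewrite mulNr expRN -ler_pdivrMr ?invr_gt0 ?expR_gt0 // invrK.
rewrite -(mulrA (4 * s ^+ 2)); apply: ler_pM => //.
- exact: sqr_ge0.
- exact: ltW.
have /andP[? ?] := ys t.
by rewrite (_ : 4 * s ^+ 2 = (2 * s) ^+ 2); [rewrite ler_sqr ?nnegrE; lra | ring].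
Qed.

(** The equation is invariant under the reversal [y(t) |-> - y(- t)], so the
    forward estimate also gives the backward one. *)
Lemma riccati_decay y K s k : 0 < k -> (forall t, k <= K t) ->
  (forall t, - s < y t < s) ->
  (forall t, is_derive t 1 y (- (s ^+ 2 - y t ^+ 2) * K t)) ->
  exists2 C, 0 <= C & forall t,
    s ^+ 2 - y t ^+ 2 <= C * expR (- (2 * s * k) * `|t|).
Proof.
move=> k_gt0 kK ys yE.
have [C C0 HC] := riccati_decay_pos k_gt0 kK ys yE.
have [|||D D0 HD] :=
  @riccati_decay_pos (fun t => - y (- t)) (fun t => K (- t)) s k k_gt0.
- by move=> t; exact: kK.
- by move=> t; have := ys (- t); rewrite ltrN2 ltrNl andbC.
- move=> t; apply: is_derive_eq (derN (der_rev (yE (- t)))) _.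
  by rewrite opprK sqrrN.
exists (C + D); first exact: addr_ge0.
move=> t; rewrite mulrDl; have [t0|t0] := leP 0 t.
  rewrite (ger0_norm t0); apply: le_trans (HC t t0) _.
  by rewrite lerDl mulr_ge0 ?expR_ge0.
have := HD (- t); rewrite opprK sqrrN oppr_ge0 => /(_ (ltW t0)) le1.
by rewrite (ltr0_norm t0); apply: le_trans le1 _; rewrite lerDr mulr_ge0 ?expR_ge0.
Qed.

End riccati.

(** * Conformal and anticonformal coordinates *)

Section coordinates.
Local Set Implicit Arguments.
Local Unset Strict Implicit.
Variable R : realType.
Implicit Types A B : 'M[R]_2.

(** Coordinates of [A] in the basis [I, Z, diag(1, -1), delta_01 + delta_10]:
    [cre A + i cim A] is the conformal part of [A] and [acre A + i acim A] its
    anticonformal part, for the identification of the plane with the complex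
    numbers. *)
Definition cre A : R := (A 0 0 + A 1 1) / 2.
Definition cim A : R := (A 1 0 - A 0 1) / 2.
Definition acre A : R := (A 0 0 - A 1 1) / 2.
Definition acim A : R := (A 0 1 + A 1 0) / 2.

Lemma sum_ord2 (F : 'I_2 -> R) : \sum_(i < 2) F i = F 0 + F 1.
Proof.
by rewrite !big_ord_recl big_ord0 addr0; congr (_ + F _); apply: val_inj.
Qed.

Lemma mx2P A B : A 0 0 = B 0 0 -> A 0 1 = B 0 1 -> A 1 0 = B 1 0 ->
  A 1 1 = B 1 1 -> A = B.
Proof.
move=> e00 e01 e10 e11; apply/matrixP => i j.
have o2 (k : 'I_2) : k = 0 \/ k = 1.
  by case: k => [[|[|k]] kP] //; [left | right]; apply: val_inj.
by case: (o2 i) => ->; case: (o2 j) => ->.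
Qed.

Lemma coordP A B : cre A = cre B -> cim A = cim B -> acre A = acre B ->
  acim A = acim B -> A = B.
Proof. by rewrite /cre /cim /acre /acim => *; apply: mx2P; lra. Qed.

Lemma mulmx2E A B i j : (A *m B) i j = A i 0 * B 0 j + A i 1 * B 1 j.
Proof. by rewrite mxE sum_ord2. Qed.

Lemma mxinnerE A B : mxinner A B =
  2 * (cre A * cre B + cim A * cim B + acre A * acre B + acim A * acim B).
Proof.
rewrite /mxinner /mxtrace sum_ord2 !mulmx2E !mxE /cre /cim /acre /acim.
by field.
Qed.

Lemma det2E A : \det A = cre A ^+ 2 + cim A ^+ 2 - acre A ^+ 2 - acim A ^+ 2.
Proof.
have l0 : lift 0 0 = 1 :> 'I_2 by apply: val_inj.
have l1 : lift 1 0 = 0 :> 'I_2 by apply: val_inj.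
rewrite (expand_det_row _ 0) sum_ord2 /cofactor !det_mx11 !mxE l0 l1 /=.
by rewrite /cre /cim /acre /acim; field.
Qed.

Lemma cofE A : [/\ cre (cof A) = cre A, cim (cof A) = cim A,
  acre (cof A) = - acre A & acim (cof A) = - acim A].
Proof.
rewrite /cof /cre /cim /acre /acim !mulmx2E !mxE /=.
by split; field.
Qed.

Lemma coordD A B : [/\ cre (A + B) = cre A + cre B, cim (A + B) = cim A + cim B,
  acre (A + B) = acre A + acre B & acim (A + B) = acim A + acim B].
Proof. by rewrite /cre /cim /acre /acim !mxE; split; field. Qed.

Lemma coordZ (k : R) A : [/\ cre (k *: A) = k * cre A, cim (k *: A) = k * cim A,
  acre (k *: A) = k * acre A & acim (k *: A) = k * acim A].
Proof. by rewrite /cre /cim /acre /acim !mxE; split; field. Qed.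

Lemma coordB A B : [/\ cre (A - B) = cre A - cre B, cim (A - B) = cim A - cim B,
  acre (A - B) = acre A - acre B & acim (A - B) = acim A - acim B].
Proof. by rewrite /cre /cim /acre /acim !mxE; split; field. Qed.

Lemma coord_Umx (x : R) : [/\ cre (Umx x) = cos x, cim (Umx x) = sin x,
  acre (Umx x) = 0 & acim (Umx x) = 0].
Proof. by rewrite /cre /cim /acre /acim !mxE /=; split; field. Qed.

Lemma coord_ZUmx (x : R) : [/\ cre (Zmx R *m Umx x) = - sin x,
  cim (Zmx R *m Umx x) = cos x, acre (Zmx R *m Umx x) = 0 &
  acim (Zmx R *m Umx x) = 0].
Proof. by rewrite /cre /cim /acre /acim !mulmx2E !mxE /=; split; field. Qed.

Lemma fnorm_sqr A : fnorm A ^+ 2 =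
  2 * (cre A ^+ 2 + cim A ^+ 2 + acre A ^+ 2 + acim A ^+ 2).
Proof.
have e : mxinner A A = 2 * (cre A ^+ 2 + cim A ^+ 2 + acre A ^+ 2 + acim A ^+ 2).
  by rewrite mxinnerE !expr2.
by rewrite /fnorm sqr_sqrtr e // mulr_ge0 // !addr_ge0 ?sqr_ge0.
Qed.

Lemma X2E A B : X2 (A, B) = 2 * (acre A * acim B - acim A * acre B).
Proof.
rewrite /X2 mxinnerE /= /cre /cim /acre /acim !mxE !sum_ord2 !mxE /=.
by field.
Qed.

Lemma X3E A B : X3 (A, B) = 2 * (cre A * cim B - cim A * cre B).
Proof.
rewrite /X3 mxinnerE /= /cre /cim /acre /acim !mxE !sum_ord2 !mxE /=.
by field.
Qed.

Lemma tangentE A B : mxinner B (cof A) =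
  2 * (cre A * cre B + cim A * cim B - acre A * acre B - acim A * acim B).
Proof. by rewrite mxinnerE; case: (cofE A) => -> -> -> ->; ring. Qed.

(** On [SL(2)], the rotations are the matrices without anticonformal part:
    [|A|^2 = 2] and [det A = 1] force it to vanish. *)
Lemma SO2E A : SL2 A -> SO2 A <-> acre A = 0 /\ acim A = 0.
Proof.
move=> A1; split.
  move=> [/matrixP AA _].
  have := fnorm_sqr A.
  have -> : fnorm A ^+ 2 = 2.
    rewrite /fnorm /mxinner (_ : A^T *m A = 1%:M); last exact/matrixP.
    by rewrite mxtrace1 sqr_sqrtr.
  move: A1; rewrite /SL2 /= det2E => e1 e2.
  have : acre A ^+ 2 + acim A ^+ 2 = 0 by lra.
  by move/eqP; rewrite paddr_eq0 ?sqr_ge0 // !sqrf_eq0 => /andP[/eqP -> /eqP ->].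
move=> [r0 s0]; split => //.
move: A1; rewrite /SL2 /= det2E r0 s0.
move: r0 s0; rewrite /acre /acim /cre /cim => r0 s0 d.
have e1 : A 1 1 = A 0 0 by lra.
have e2 : A 0 1 = - A 1 0 by lra.
rewrite e1 e2 in d.
by apply: mx2P; rewrite !mxE !sum_ord2 !mxE /= ?e1 ?e2; lra.
Qed.

End coordinates.

(** * Derivatives, Gronwall's inequality and polar angles *)

Section coordinate_calculus.
Local Set Implicit Arguments.
Local Unset Strict Implicit.
Variable R : realType.
Implicit Types t : R.

Lemma is_derive_unique (f : R -> R) (t a b : R) :
  is_derive t 1 f a -> is_derive t 1 f b -> a = b.
Proof.
move=> h1 h2.
by rewrite -(@derive_val _ _ _ _ _ _ _ h1) (@derive_val _ _ _ _ _ _ _ h2).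
Qed.

(** Both [f(t) expR (k t)] (nondecreasing) and [f(t) expR (- k t)]
    (nonincreasing) vanish at [t0]. *)
Lemma gronwall_zero (f df : R -> R) (k t0 : R) : (forall t, 0 <= f t) ->
  (forall t, is_derive t 1 f (df t)) -> (forall t, `|df t| <= k * f t) ->
  f t0 = 0 -> forall t, f t = 0.
Proof.
move=> f0 fE dfk ft0 t.
have gE (m u : R) : is_derive u 1 (fun x => f x * expR (m * x))
    ((df u + m * f u) * expR (m * u)).
  by apply: is_derive_eq (derM (fE u) (der_expR_lin m u)) _; ring.
have [tt0|tt0] := leP t t0.
  have := derive_ge0_nondecreasing (gE k) _ tt0; rewrite ft0 mul0r => le0.
  have : f t * expR (k * t) <= 0.
    apply: le0 => u; rewrite mulr_ge0 ?expR_ge0 //.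
    by have := dfk u; rewrite ler_norml => /andP[]; lra.
  by rewrite pmulr_lle0 ?expR_gt0 // => ft; apply/eqP; rewrite eq_le ft f0.
have := derive_le0_nonincreasing (gE (- k)) _ (ltW tt0); rewrite ft0 mul0r => le0.
have : f t * expR (- k * t) <= 0.
  apply: le0 => u; rewrite mulr_le0_ge0 ?expR_ge0 //.
  by have := dfk u; rewrite ler_norml => /andP[]; lra.
by rewrite pmulr_lle0 ?expR_gt0 // => ft; apply/eqP; rewrite eq_le ft f0.
Qed.

Lemma circle_angle (a b : R) : a ^+ 2 + b ^+ 2 = 1 ->
  exists x, a = cos x /\ b = sin x.
Proof.
move=> ab.
have a1 : -1 <= a <= 1.
  rewrite -ler_norml -(ler_sqr (normr_ge0 _)) ?nnegrE // expr1n.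
  by rewrite real_normK ?num_real //; have := sqr_ge0 b; lra.
have b2 : 1 - a ^+ 2 = b ^+ 2 by lra.
have [b0|b0] := leP 0 b.
  exists (acos a); rewrite acosK ?in_itv //= sin_acos // b2 sqrtr_sqr.
  by rewrite ger0_norm.
exists (- acos a); rewrite cosN sinN acosK ?in_itv //= sin_acos // b2 sqrtr_sqr.
by rewrite ltr0_norm // opprK.
Qed.

Lemma is_derive_mx (M : R -> 'M[R]_2) (D : 'M[R]_2) (t : R) :
  (forall i j, is_derive t 1 (fun x => M x i j) (D i j)) ->
  is_derive t 1 M D.
Proof.
move=> h.
have dM : derivable M t 1 by apply/derivable_mxP => i j; case: (h i j).
split=> //; rewrite derive_mx //; apply/matrixP => i j; rewrite mxE.
exact: (@derive_val _ _ _ _ _ _ _ (h i j)).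
Qed.

Lemma is_derive_entry (M : R -> 'M[R]_2) (t : R) i j : derivable M t 1 ->
  is_derive t 1 (fun x => M x i j) (derive1 M t i j).
Proof.
move=> dM; have /derivable_mxP/(_ i j) dij := dM.
by split=> //; rewrite derive1E derive_mx // mxE.
Qed.

Lemma is_derive_coord (M : R -> 'M[R]_2) (t : R) : derivable M t 1 ->
  [/\ is_derive t 1 (fun x => cre (M x)) (cre (derive1 M t)),
      is_derive t 1 (fun x => cim (M x)) (cim (derive1 M t)),
      is_derive t 1 (fun x => acre (M x)) (acre (derive1 M t)) &
      is_derive t 1 (fun x => acim (M x)) (acim (derive1 M t))].
Proof.
move=> dM; have e i j := is_derive_entry i j dM.
have sc (f : R -> R) (a : R) : is_derive t 1 f a ->
    is_derive t 1 (fun x : R => f x / 2) (a / 2 : R).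
  move=> h; apply: is_derive_eq (derM h (derC 2^-1 t)) _.
  by rewrite mulr0 add0r mulrC.
(* each remaining sum of entries is differentiated by instance resolution,
   from the hypothesis [e] *)
split; apply: sc.
Qed.

End coordinate_calculus.

(** * Rigid rotations *)

Section rotation.
Local Set Implicit Arguments.
Local Unset Strict Implicit.
Variable R : realType.
Implicit Types (M N : 'M[R]_2) (w : R).

(** The curve [cos (w t) M + sin (w t) N]; this family is closed under
    differentiation and contains [Umx (w t)]. *)
Definition trig_mx w M N (t : R) : 'M[R]_2 :=
  cos (w * t) *: M + sin (w * t) *: N.

Lemma is_derive_trig_mx w M N (t : R) :
  is_derive t 1 (trig_mx w M N) (trig_mx w (w *: N) (- w *: M) t).
Proof.
apply: is_derive_mx => i j.
have hw : is_derive t 1 (fun x : R => w * x) w.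
  have := derM (derC w t) (is_derive_id t 1).
  by rewrite mulr1 mulr0 addr0.
have hc := @is_derive1_comp _ cos (fun x => w * x) _ _ _ (is_derive_cos _) hw.
have hs := @is_derive1_comp _ sin (fun x => w * x) _ _ _ (is_derive_sin _) hw.
have := derD (derM hc (derC (M i j) t)) (derM hs (derC (N i j) t)).
rewrite (_ : (fun x => trig_mx w M N x i j) =
  fun x => (cos \o [eta *%R w]) x * M i j + (sin \o [eta *%R w]) x * N i j);
  last first.
  by apply/funext => x; rewrite /trig_mx !mxE.
by move=> h; apply: is_derive_eq h _; rewrite /trig_mx !mxE /=; ring.
Qed.

Lemma derive1_trig_mx w M N :
  derive1 (trig_mx w M N) = trig_mx w (w *: N) (- w *: M).
Proof.
apply/funext => t; rewrite derive1E.
exact: (@derive_val _ _ _ _ _ _ _ (is_derive_trig_mx w M N t)).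
Qed.

Lemma continuous_trig_mx w M N : continuous (trig_mx w M N).
Proof.
move=> t; apply: differentiable_continuous; apply/derivable1_diffP.
by case: (is_derive_trig_mx w M N t).
Qed.

Lemma rotationE w : (fun t => Umx (w * t)) = trig_mx w 1%:M (Zmx R).
Proof. by []. Qed.

Lemma phase_rotation w t : phase (fun t => Umx (w * t)) t =
  (Umx (w * t), w *: (Zmx R *m Umx (w * t))).
Proof.
rewrite /phase rotationE derive1_trig_mx /trig_mx -/(Umx _); congr pair.
apply: mx2P; rewrite !mxE ?sum_ord2 !mxE ?sum_ord2 ?mxE /=; ring.
Qed.

Lemma rigid_rotation kappa w : is_rigid_rotation kappa (fun t => Umx (w * t)).
Proof.
have det1 x : SL2 (Umx x : 'M[R]_2).
  rewrite /SL2 /= det2E; case: (coord_Umx x) => -> -> -> ->.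
  by rewrite expr0n /= !subr0 cos2Dsin2.
have so t : SO2 (Umx (w * t) : 'M[R]_2).
  by apply/(SO2E (det1 _)); case: (coord_Umx (w * t)) => _ _ -> ->.
split=> //; split=> //.
- by rewrite rotationE; exact: continuous_trig_mx.
- rewrite rotationE; split.
  + by move=> t; case: (is_derive_trig_mx w 1%:M (Zmx R) t).
  + move=> t; rewrite derive1_trig_mx.
    by case: (is_derive_trig_mx w (w *: Zmx R) (- w *: 1%:M) t).
  + by rewrite !derive1_trig_mx; exact: continuous_trig_mx.
- exists (fun _ => kappa - w ^+ 2); first by move=> t; exact: cvg_cst.
  move=> t; rewrite rotationE !derive1_trig_mx.
  have -> : cof (trig_mx w 1%:M (Zmx R) t) = trig_mx w 1%:M (Zmx R) t.
    have := coord_Umx (w * t); rewrite /Umx -/(trig_mx w _ _ t) => -[_ _ r0 s0].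
    have := cofE (trig_mx w 1%:M (Zmx R) t).
    rewrite r0 s0 oppr0 => -[e1 e2 e3 e4].
    by apply: coordP => //; rewrite ?e3 ?e4 ?r0 ?s0.
  apply: mx2P; rewrite /trig_mx !mxE /=; ring.
Qed.

End rotation.

(** * The level set and the distance to the rotation orbit *)

Section level_set.
Local Set Implicit Arguments.
Local Unset Strict Implicit.

Lemma angular_velocity_neq0 (R : realType) (kappa x : R) :
  0 < kappa -> 8 * kappa < x ^+ 2 -> x / 2 != 0.
Proof.
by move=> k0 kx; rewrite mulf_neq0 ?invr_eq0 // -sqrf_eq0 gt_eqF //; lra.
Qed.

Variables (R : realType) (kappa X1bar X3bar : R).
Hypothesis X1barE : X1bar = kappa + X3bar ^+ 2 / 4.
Implicit Types A B : 'M[R]_2.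

Let w : R := X3bar / 2.
Let W := Wset kappa X1bar X3bar.
Let S := Rset kappa X1bar X3bar.

(** The conditions defining the level set, in coordinates, with [w = X3bar / 2]
    the angular velocity. *)
Lemma WsetE A B : W (A, B) <->
  [/\ cre A ^+ 2 + cim A ^+ 2 - acre A ^+ 2 - acim A ^+ 2 = 1,
      cre A * cre B + cim A * cim B - acre A * acre B - acim A * acim B = 0,
      cre B ^+ 2 + cim B ^+ 2 + acre B ^+ 2 + acim B ^+ 2 +
        kappa * (cre A ^+ 2 + cim A ^+ 2 + acre A ^+ 2 + acim A ^+ 2) =
        kappa + w ^+ 2,
      cre A * cim B - cim A * cre B = w &
      acre A * acim B - acim A * acre B = 0].
Proof.
have wE : w ^+ 2 = X3bar ^+ 2 / 4 by rewrite /w; field.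
rewrite /W /Wset /tangent_bundle /SL2 /= X3E X2E tangentE det2E.
rewrite /X1 !fnorm_sqr X1barE wE /w; split.
  by move=> [[e1 e2] e3 e4 e5]; split; lra.
by move=> [e1 e2 e3 e4 e5]; split; [split|..]; lra.
Qed.

Lemma Rset_range : w != 0 -> S = range (phase (fun t => Umx (w * t))).
Proof.
move=> w0; apply/seteqP; split=> [[A B] [WAB]|_ [t _ <-]].
  have [e1 e2 e3 e4 e5] := (WsetE A B).1 WAB.
  have A1 : SL2 A by rewrite /SL2 /= det2E.
  move=> /(SO2E A1)[r0 s0].
  move: e1 e2 e3; rewrite r0 s0 !mul0r !subr0 !expr0n /= !addr0 !subr0 => e1 e2 e3.
  have [x [px qx]] := circle_angle e1.
  (* u' = i w u, and the energy leaves nothing for v' *)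
  have p1 : cre B = - w * cim A.
    rewrite -[cre B]mul1r -e1.
    have -> : (cre A ^+ 2 + cim A ^+ 2) * cre B =
      cre A * (cre A * cre B + cim A * cim B) -
      cim A * (cre A * cim B - cim A * cre B) by ring.
    by rewrite e2 e4; ring.
  have q1 : cim B = w * cre A.
    rewrite -[cim B]mul1r -e1.
    have -> : (cre A ^+ 2 + cim A ^+ 2) * cim B =
      cim A * (cre A * cre B + cim A * cim B) +
      cre A * (cre A * cim B - cim A * cre B) by ring.
    by rewrite e2 e4; ring.
  have e6 : cre B ^+ 2 + cim B ^+ 2 = w ^+ 2.
    by rewrite p1 q1 -[RHS]mulr1 -e1; ring.
  have : acre B ^+ 2 + acim B ^+ 2 = 0 by rewrite e1 in e3; lra.
  move/eqP; rewrite paddr_eq0 ?sqr_ge0 // !sqrf_eq0 => /andP[/eqP r1 /eqP s1].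
  exists (x / w) => //; rewrite phase_rotation mulrC divfK //.
  have [c1 c2 c3 c4] := coord_Umx x.
  have [d1 d2 d3 d4] := coord_ZUmx x.
  have [f1 f2 f3 f4] := coordZ w (Zmx R *m Umx x).
  congr pair; apply: coordP.
  - by rewrite c1.
  - by rewrite c2.
  - by rewrite c3.
  - by rewrite c4.
  - by rewrite f1 d1 p1 qx; ring.
  - by rewrite f2 d2 q1 px; ring.
  - by rewrite f3 d3 r1 mulr0.
  - by rewrite f4 d4 s1 mulr0.
have [[_ _ _ _] so] := rigid_rotation kappa w.
split; last exact: so.
rewrite phase_rotation; apply/WsetE.
set x := w * t.
have [c1 c2 c3 c4] := coord_Umx x.
have [d1 d2 d3 d4] := coord_ZUmx x.
have [f1 f2 f3 f4] := coordZ w (Zmx R *m Umx x).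
rewrite f1 f2 f3 f4 d1 d2 d3 d4 c1 c2 c3 c4.
have cs (k : R) : k * cos x ^+ 2 + k * sin x ^+ 2 = k.
  by rewrite -mulrDr cos2Dsin2 mulr1.
have := (cs 1, cs kappa, cs (w ^+ 2), cs w) => -[[[h1 hk] hw2] hw].
by split; [lra | ring | lra | lra | ring].
Qed.

Lemma dist_to_set_ge0 A B : w != 0 -> 0 <= dist_to_set (A, B) S.
Proof.
move=> w0; apply: lb_le_inf.
  rewrite Rset_range //; eexists.
  by exists (phase (fun t => Umx (w * t)) 0) => //; exists 0.
by move=> _ [q _ <-]; exact: sqrtr_ge0.
Qed.

(** The competitor in the infimum is the point of the orbit whose conformal part
    is [u / |u|], where [|u|^2 = 1 + |v|^2]. *)
Lemma dist_to_rotation_le A B : w != 0 -> 0 < kappa -> W (A, B) ->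
  dist_to_set (A, B) S <=
  Num.sqrt (4 * (1 + w ^+ 2) * (acre A ^+ 2 + acim A ^+ 2)).
Proof.
move=> w0 k0 /WsetE[e1 e2 e3 e4 e5].
set sg := acre A ^+ 2 + acim A ^+ 2.
have sg0 : 0 <= sg by rewrite addr_ge0 ?sqr_ge0.
pose rho := Num.sqrt (1 + sg).
have rho2 : rho ^+ 2 = 1 + sg by rewrite sqr_sqrtr // addr_ge0.
have rho1 : 1 <= rho by rewrite -[1]sqrtr1 ler_sqrt ?lerDl // addr_ge0.
have rho_neq0 : rho != 0 by rewrite lt0r_neq0 // (lt_le_trans ltr01).
have [|x [cx sx]] := @circle_angle R (cre A / rho) (cim A / rho).
  have -> : (cre A / rho) ^+ 2 + (cim A / rho) ^+ 2 =
    (cre A ^+ 2 + cim A ^+ 2) / rho ^+ 2 by field.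
  rewrite rho2 (_ : cre A ^+ 2 + cim A ^+ 2 = 1 + sg).
    by rewrite divff // -rho2 expf_neq0.
  by rewrite /sg; lra.
have le_d : dist_to_set (A, B) S <=
    Defs.edist (A, B) (phase (fun t => Umx (w * t)) (x / w)).
  apply: ge_inf.
    by exists 0 => _ [q _ <-]; exact: sqrtr_ge0.
  exists (phase (fun t => Umx (w * t)) (x / w)) => //.
  by rewrite Rset_range //; exists (x / w).
apply: le_trans le_d _.
rewrite phase_rotation (mulrC w) divfK // /Defs.edist /=.
apply: ler_wsqrtr; rewrite !fnorm_sqr.
have [c1 c2 c3 c4] := coord_Umx x.
have [d1 d2 d3 d4] := coord_ZUmx x.
have [f1 f2 f3 f4] := coordZ w (Zmx R *m Umx x).
have [g1 g2 g3 g4] := coordB A (Umx x).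
have [h1 h2 h3 h4] := coordB B (w *: (Zmx R *m Umx x)).
rewrite g1 g2 g3 g4 h1 h2 h3 h4 f1 f2 f3 f4 d1 d2 d3 d4 c1 c2 c3 c4.
have pE : cre A = rho * cos x by rewrite -cx mulrC divfK.
have qE : cim A = rho * sin x by rewrite -sx mulrC divfK.
have cs (k : R) : k * cos x ^+ 2 + k * sin x ^+ 2 = k.
  by rewrite -mulrDr cos2Dsin2 mulr1.
set b1 := cre B in e2 e3 e4 *; set b2 := cim B in e2 e3 e4 *.
set V := acre B ^+ 2 + acim B ^+ 2.
have up : cos x * b2 - sin x * b1 = w / rho.
  by rewrite -e4 pE qE; field.
have d_u : (cre A - cos x) ^+ 2 + (cim A - sin x) ^+ 2 = (rho - 1) ^+ 2.
  by rewrite pE qE; move: (cs ((rho - 1) ^+ 2)); lra.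
have d_u' : (b1 - w * - sin x) ^+ 2 + (b2 - w * cos x) ^+ 2 =
   b1 ^+ 2 + b2 ^+ 2 + w ^+ 2 - 2 * w * (w / rho).
  by rewrite -up; move: (cs (w ^+ 2)); lra.
(* the energy bounds [|u'|^2 + |v'|^2] as a whole *)
have en : b1 ^+ 2 + b2 ^+ 2 + V = w ^+ 2 - 2 * kappa * sg.
  have := e3; rewrite /V /sg.
  rewrite (_ : cre A ^+ 2 + cim A ^+ 2 = 1 + sg); last by rewrite /sg; lra.
  by rewrite /sg; lra.
have sq : (rho - 1) ^+ 2 <= sg by nra.
have inv1 : 1 - rho^-1 <= sg.
  have -> : 1 - rho^-1 = (rho - 1) / rho by field.
  by rewrite ler_pdivrMr ?(lt_le_trans ltr01) //; nra.
have inv2 : w ^+ 2 * (1 - rho^-1) <= w ^+ 2 * sg by rewrite ler_wpM2l ?sqr_ge0.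
have ksg : 0 <= kappa * sg by rewrite mulr_ge0 // ltW.
rewrite !subr0 mulr0 !subr0.
rewrite -/sg -/V.
have -> : 2 * ((cre A - cos x) ^+ 2 + (cim A - sin x) ^+ 2 +
    acre A ^+ 2 + acim A ^+ 2)
  = 2 * ((rho - 1) ^+ 2 + sg) by rewrite -d_u /sg; ring.
have -> : 2 * ((b1 - w * - sin x) ^+ 2 + (b2 - w * cos x) ^+ 2 +
    acre B ^+ 2 + acim B ^+ 2)
  = 2 * (2 * (w ^+ 2 * (1 - rho^-1)) - 2 * (kappa * sg)).
  have -> : 2 * ((b1 - w * - sin x) ^+ 2 + (b2 - w * cos x) ^+ 2 +
    acre B ^+ 2 + acim B ^+ 2)
    = 2 * ((b1 - w * - sin x) ^+ 2 + (b2 - w * cos x) ^+ 2 + V) by rewrite /V; ring.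
  by rewrite d_u' (_ : b1 ^+ 2 + b2 ^+ 2 = w ^+ 2 - 2 * kappa * sg - V);
    [ring | lra].
by lra.
Qed.

End level_set.

(** * Dynamics of solutions *)

Section solution.
Local Set Implicit Arguments.
Local Unset Strict Implicit.
Variables (R : realType) (kappa : R) (A : R -> 'M[R]_2).
Hypothesis solA : is_solution kappa A.
Implicit Types t : R.

(** Coordinates of [A], [A'] and [A'']; in complex notation [u = p + i q] and
    [v = r + i s], and similarly for the derivatives. *)
Let A1 := derive1 A.
Let A2 := derive1 (derive1 A).
Let p t := cre (A t).
Let q t := cim (A t).
Let r t := acre (A t).
Let s t := acim (A t).
Let p1 t := cre (A1 t).
Let q1 t := cim (A1 t).
Let r1 t := acre (A1 t).
Let s1 t := acim (A1 t).
Let p2 t := cre (A2 t).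
Let q2 t := cim (A2 t).
Let r2 t := acre (A2 t).
Let s2 t := acim (A2 t).

Lemma det_coord t : p t ^+ 2 + q t ^+ 2 - r t ^+ 2 - s t ^+ 2 = 1.
Proof. by case: solA => _ /(_ t) + _ _; rewrite /SL2 /= det2E. Qed.

Lemma derive_coord t :
  [/\ is_derive t 1 p (p1 t), is_derive t 1 q (q1 t),
      is_derive t 1 r (r1 t) & is_derive t 1 s (s1 t)].
Proof. by case: solA => _ _ [dA _ _] _; exact: is_derive_coord. Qed.

Lemma derive2_coord t :
  [/\ is_derive t 1 p1 (p2 t), is_derive t 1 q1 (q2 t),
      is_derive t 1 r1 (r2 t) & is_derive t 1 s1 (s2 t)].
Proof. by case: solA => _ _ [_ dA _] _; exact: is_derive_coord. Qed.

Lemma ode_coord t : exists l : R,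
  [/\ p2 t = (l - kappa) * p t, q2 t = (l - kappa) * q t,
      r2 t = - (l + kappa) * r t & s2 t = - (l + kappa) * s t].
Proof.
case: solA => _ _ _ [lam _ /(_ t) E]; exists (lam t).
have [c1 c2 c3 c4] := cofE (A t).
have [d1 d2 d3 d4] := coordD (A2 t) (kappa *: A t).
have [z1 z2 z3 z4] := coordZ kappa (A t).
have [y1 y2 y3 y4] := coordZ (lam t) (cof (A t)).
rewrite -/(A2 t) in E.
rewrite E y1 c1 z1 in d1; rewrite E y2 c2 z2 in d2.
rewrite E y3 c3 z3 in d3; rewrite E y4 c4 z4 in d4.
by rewrite /p /q /r /s /p2 /q2 /r2 /s2; split; lra.
Qed.

Lemma tangent_coord t : p t * p1 t + q t * q1 t - r t * r1 t - s t * s1 t = 0.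
Proof.
have [dp dq dr ds] := derive_coord t.
have h := derB
  (derB (derD (derM dp dp) (derM dq dq)) (derM dr dr))
  (derM ds ds).
have /(is_derive_unique h) : is_derive t 1
    (fun x => p x * p x + q x * q x - r x * r x - s x * s x) 0.
  rewrite (_ : (fun _ => _) = fun=> 1); first exact: derC.
  by apply/funext => x; rewrite -!expr2 det_coord.
by lra.
Qed.

(** The tangency condition differentiated once more; it determines the
    multiplier [lambda]. *)
Lemma tangent2_coord t : p1 t ^+ 2 + q1 t ^+ 2 - r1 t ^+ 2 - s1 t ^+ 2 +
  (p t * p2 t + q t * q2 t - r t * r2 t - s t * s2 t) = 0.
Proof.
have [dp dq dr ds] := derive_coord t.
have [dp1 dq1 dr1 ds1] := derive2_coord t.
have h := derB
  (derB (derD (derM dp dp1) (derM dq dq1)) (derM dr dr1))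
  (derM ds ds1).
have /(is_derive_unique h) : is_derive t 1
    (fun x => p x * p1 x + q x * q1 x - r x * r1 x - s x * s1 x) 0.
  rewrite (_ : (fun _ => _) = fun=> 0); first exact: derC.
  by apply/funext => x; rewrite tangent_coord.
by lra.
Qed.

Lemma energy_const t u :
  p1 t ^+ 2 + q1 t ^+ 2 + r1 t ^+ 2 + s1 t ^+ 2 +
    kappa * (p t ^+ 2 + q t ^+ 2 + r t ^+ 2 + s t ^+ 2) =
  p1 u ^+ 2 + q1 u ^+ 2 + r1 u ^+ 2 + s1 u ^+ 2 +
    kappa * (p u ^+ 2 + q u ^+ 2 + r u ^+ 2 + s u ^+ 2).
Proof.
apply: (@derive0_const _ (fun x => p1 x ^+ 2 + q1 x ^+ 2 + r1 x ^+ 2 + s1 x ^+ 2 +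
    kappa * (p x ^+ 2 + q x ^+ 2 + r x ^+ 2 + s x ^+ 2))) => {t u} t.
have [dp dq dr ds] := derive_coord t.
have [dp1 dq1 dr1 ds1] := derive2_coord t.
have [l [e1 e2 e3 e4]] := ode_coord t.
have tg := tangent_coord t.
have h := derD
  (derD (derD (derD (derM dp1 dp1) (derM dq1 dq1)) (derM dr1 dr1))
     (derM ds1 ds1))
  (derM (derC kappa t)
     (derD (derD (derD (derM dp dp) (derM dq dq)) (derM dr dr))
        (derM ds ds))).
apply: is_derive_eq h _; rewrite e1 e2 e3 e4.
transitivity (2 * l * (p t * p1 t + q t * q1 t - r t * r1 t - s t * s1 t)).
  by ring.
by rewrite tg mulr0.
Qed.

Lemma momentum_conformal_const t u :
  p t * q1 t - q t * p1 t = p u * q1 u - q u * p1 u.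
Proof.
apply: (@derive0_const _ (fun x => p x * q1 x - q x * p1 x)) => {t u} t.
have [dp dq _ _] := derive_coord t.
have [dp1 dq1 _ _] := derive2_coord t.
have [l [e1 e2 _ _]] := ode_coord t.
have h := derB (derM dp dq1) (derM dq dp1).
by apply: is_derive_eq h _; rewrite e1 e2; ring.
Qed.

Lemma momentum_anticonformal_const t u :
  r t * s1 t - s t * r1 t = r u * s1 u - s u * r1 u.
Proof.
apply: (@derive0_const _ (fun x => r x * s1 x - s x * r1 x)) => {t u} t.
have [_ _ dr ds] := derive_coord t.
have [_ _ dr1 ds1] := derive2_coord t.
have [l [_ _ e3 e4]] := ode_coord t.
have h := derB (derM dr ds1) (derM ds dr1).
by apply: is_derive_eq h _; rewrite e3 e4; ring.
Qed.

Variables (X1bar X3bar : R).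
Hypothesis X1barE : X1bar = kappa + X3bar ^+ 2 / 4.

Lemma Wset_invariant : Wset kappa X1bar X3bar (phase A 0) ->
  forall t, Wset kappa X1bar X3bar (phase A t).
Proof.
move=> /(WsetE X1barE)[_ _ E3 E4 E5] t; apply/(WsetE X1barE); split.
- exact: det_coord.
- exact: tangent_coord.
- by rewrite -E3; exact: energy_const.
- by rewrite -E4; exact: momentum_conformal_const.
- by rewrite -E5; exact: momentum_anticonformal_const.
Qed.

Hypothesis kappa_gt0 : 0 < kappa.
Hypothesis X3bar_gt : 8 * kappa < X3bar ^+ 2.
Hypothesis WA : forall t, Wset kappa X1bar X3bar (phase A t).

Let c : R := X3bar ^+ 2 - 8 * kappa.
(** [sg] is the squared modulus of the anticonformal part, and [2 m] is its
    derivative. *)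
Let sg t := r t ^+ 2 + s t ^+ 2.
Let m t := r t * r1 t + s t * s1 t.

Lemma sg_ge0 t : 0 <= sg t. Proof. by rewrite addr_ge0 ?sqr_ge0. Qed.

Let c_gt0 : 0 < c. Proof. by rewrite subr_gt0. Qed.

Lemma derive_sg t : is_derive t 1 sg (2 * m t).
Proof.
have [_ _ dr ds] := derive_coord t.
by apply: is_derive_eq (derD (derM dr dr) (derM ds ds)) _; rewrite /m; ring.
Qed.

(** Lagrange's identity, where [X2 = 0] removes the second square. *)
Lemma lagrange_sg t : sg t * (r1 t ^+ 2 + s1 t ^+ 2) = m t ^+ 2.
Proof.
have [_ _ _ _ E5] := (WsetE X1barE _ _).1 (WA t).
have -> : sg t * (r1 t ^+ 2 + s1 t ^+ 2) =
    m t ^+ 2 + (r t * s1 t - s t * r1 t) ^+ 2 by rewrite /sg /m; ring.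
by rewrite [X in _ + X ^+ 2]E5 expr0n addr0.
Qed.

(** Multiply the energy identity by [|v|^2 |u|^2] and eliminate the velocities
    with Lagrange's identity for [u] and for [v]. *)
Lemma first_integral t :
  4 * m t ^+ 2 * (1 + 2 * sg t) = sg t ^+ 2 * (c - 8 * kappa * sg t).
Proof.
have [E1 E2 E3 E4 _] := (WsetE X1barE _ _).1 (WA t).
rewrite -/(p t) -/(q t) -/(r t) -/(s t) -/(A1 t) -/(p1 t) -/(q1 t) -/(r1 t)
  -/(s1 t) in E1 E2 E3 E4.
have L1 := lagrange_sg t.
set V := r1 t ^+ 2 + s1 t ^+ 2 in L1.
set U := p1 t ^+ 2 + q1 t ^+ 2.
have pq : p t ^+ 2 + q t ^+ 2 = 1 + sg t by rewrite /sg; lra.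
have L2 : (1 + sg t) * U = m t ^+ 2 + X3bar ^+ 2 / 4.
  have -> : m t = p t * p1 t + q t * q1 t by rewrite /m; lra.
  have -> : X3bar ^+ 2 / 4 = (p t * q1 t - q t * p1 t) ^+ 2 by rewrite E4; field.
  by rewrite -pq /U; ring.
have en : U + V + 2 * kappa * sg t = X3bar ^+ 2 / 4.
  have := E3; rewrite pq (_ : (X3bar / 2) ^+ 2 = X3bar ^+ 2 / 4); last by field.
  by rewrite /U /V /sg; lra.
have := congr1 (fun z => z * (sg t * (1 + sg t))) en => /= en2.
have e1 : (1 + sg t) * (sg t * V) = (1 + sg t) * m t ^+ 2 by rewrite L1.
have e2 : sg t * ((1 + sg t) * U) = sg t * (m t ^+ 2 + X3bar ^+ 2 / 4) by rewrite L2.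
by rewrite /c; lra.
Qed.

(** The first integral gives [sg'^2 <= c sg^2]. *)
Lemma sg_dichotomy t0 : sg t0 = 0 -> forall t, sg t = 0.
Proof.
apply: (gronwall_zero sg_ge0 derive_sg (k := Num.sqrt c)) => t.
rewrite -ler_sqr ?nnegrE ?mulr_ge0 ?sqrtr_ge0 ?sg_ge0 //.
rewrite exprMn sqr_sqrtr ?(ltW c_gt0) // real_normK ?num_real //.
have F := first_integral t; have g0 := sg_ge0 t.
have s1_gt0 : 0 < 1 + 2 * sg t by lra.
rewrite -(ler_pM2r s1_gt0) exprMn (_ : 2 ^+ 2 = 4) ?F; last by ring.
have k0 : 0 <= sg t ^+ 2 * (kappa * sg t).
  by rewrite mulr_ge0 ?sqr_ge0 // mulr_ge0 // ltW.
have c0 : 0 <= sg t ^+ 2 * (c * sg t).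
  by rewrite mulr_ge0 ?sqr_ge0 // mulr_ge0 // ltW // c_gt0.
by lra.
Qed.

(** An orbit in the level set meets the rotation orbit exactly when [sg]
    vanishes. *)
Lemma Rset_sg t : Rset kappa X1bar X3bar (phase A t) <-> sg t = 0.
Proof.
have At : SL2 (A t) by case: solA => _ + _ _; exact.
split=> [[_ /(SO2E At)[r0 s0]]|/eqP].
  by rewrite /sg /r /s r0 s0 expr0n addr0.
rewrite paddr_eq0 ?sqr_ge0 // !sqrf_eq0 => /andP[/eqP r0 /eqP s0].
by split; [exact: WA | apply/(SO2E At)].
Qed.

Hypothesis sg_gt0 : forall t, 0 < sg t.

(** The logarithmic derivative of [sg]. *)
Let y t := 2 * m t / sg t.

Lemma logder_sqr t : y t ^+ 2 * (1 + 2 * sg t) = c - 8 * kappa * sg t.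
Proof.
have F := first_integral t; have g0 := lt0r_neq0 (sg_gt0 t).
have -> : y t ^+ 2 * (1 + 2 * sg t) = 4 * m t ^+ 2 * (1 + 2 * sg t) / sg t ^+ 2.
  by rewrite /y; field.
by rewrite F; field.
Qed.

(** The second derivative of [sg] involves [lambda], which the differentiated
    constraint expresses through the speeds [V = |v'|^2] and [U = |u'|^2]; both
    are functions of [sg] and [y]. *)
Lemma derive_logder t :
  is_derive t 1 y (- (c - y t ^+ 2) * (2 * (1 + 2 * sg t))^-1).
Proof.
have g0 := lt0r_neq0 (sg_gt0 t).
have [_ _ dr ds] := derive_coord t.
have [_ _ dr1 ds1] := derive2_coord t.
have dm := derM (derC 2 t) (derD (derM dr dr1) (derM ds ds1)).
have h := derM dm (@derV _ sg t _ g0 (derive_sg t)).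
apply: is_derive_eq h _.
have [l [l1 l2 l3 l4]] := ode_coord t.
have T2 := tangent2_coord t.
have [E1 E2 E3 E4 _] := (WsetE X1barE _ _).1 (WA t).
rewrite -/(p t) -/(q t) -/(r t) -/(s t) -/(A1 t) -/(p1 t) -/(q1 t) -/(r1 t)
  -/(s1 t) in E1 E2 E3 E4.
have ys := logder_sqr t.
have L1 := lagrange_sg t.
set V := r1 t ^+ 2 + s1 t ^+ 2 in L1.
set U := p1 t ^+ 2 + q1 t ^+ 2.
have mE : m t = sg t * y t / 2 by rewrite /y; field.
have VE : V = sg t * y t ^+ 2 / 4.
  by apply: (mulfI g0); rewrite L1 mE; field.
have pq : p t ^+ 2 + q t ^+ 2 = 1 + sg t by rewrite /sg; lra.
have en : U + V + 2 * kappa * sg t = X3bar ^+ 2 / 4.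
  have := E3; rewrite pq (_ : (X3bar / 2) ^+ 2 = X3bar ^+ 2 / 4); last by field.
  by rewrite /U /V /sg; lra.
have lE : l * (1 + 2 * sg t) = kappa + V - U.
  have pp : p t * p2 t + q t * q2 t = (l - kappa) * (1 + sg t).
    by rewrite l1 l2 -pq; ring.
  have rr : r t * r2 t + s t * s2 t = - (l + kappa) * sg t.
    by rewrite l3 l4 /sg; ring.
  by move: T2; rewrite /U /V; lra.
have g1 : 1 + 2 * sg t != 0 by rewrite lt0r_neq0 //; have := sg_gt0 t; lra.
transitivity (2 * V / sg t - 2 * (l + kappa) - y t ^+ 2).
  rewrite l3 l4 mulr0 addr0.
  have -> : r t * (- (l + kappa) * r t) + r1 t * r1 t +
      (s t * (- (l + kappa) * s t) + s1 t * s1 t) = V - (l + kappa) * sg t.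
    by rewrite /V /sg; ring.
  by rewrite -/(m t) mE; field.
apply: (mulIf g1).
have -> : - (c - y t ^+ 2) / (2 * (1 + 2 * sg t)) * (1 + 2 * sg t) =
  - (c - y t ^+ 2) / 2 by field.
transitivity (2 * V / sg t * (1 + 2 * sg t) - y t ^+ 2 * (1 + 2 * sg t)
  - 2 * (l * (1 + 2 * sg t)) - 2 * kappa * (1 + 2 * sg t)); first by ring.
have -> : 2 * V / sg t * (1 + 2 * sg t) = y t ^+ 2 * (1 + 2 * sg t) / 2.
  by rewrite VE; field.
rewrite lE.
have -> : kappa + V - U = kappa + 2 * V + 2 * kappa * sg t - X3bar ^+ 2 / 4 by lra.
rewrite ys VE.
have ys2 : 2 * (y t ^+ 2 * sg t) = c - 8 * kappa * sg t - y t ^+ 2.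
  by rewrite -ys; ring.
by move: ys2; rewrite /c; lra.
Qed.

(** By [logder_sqr], [sg <= c / (8 kappa)], so the Riccati coefficient
    [1 / (2 (1 + 2 sg))] is bounded below; and [8 kappa sg <= c - y^2]. *)
Lemma sg_decay : exists C n : R, [/\ 0 <= C, 0 < n &
  forall t, sg t <= C * expR (- (2 * n) * `|t|)].
Proof.
have c0 := c_gt0.
pose M : R := c / (8 * kappa).
pose k : R := (2 * (1 + 2 * M))^-1.
have k8 : 0 < 8 * kappa by rewrite mulr_gt0.
have sg_le t : sg t <= M.
  rewrite /M ler_pdivlMr // mulrC -subr_ge0 -logder_sqr mulr_ge0 ?sqr_ge0 //.
  by have := sg_gt0 t; lra.
have M_gt0 : 0 < M by rewrite divr_gt0.
have k_gt0 : 0 < k.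
  by rewrite invr_gt0; lra.
have y2 t : y t ^+ 2 < c.
  have ys := logder_sqr t; have g0 := sg_gt0 t.
  have : 0 < kappa * sg t by rewrite mulr_gt0.
  have : 0 <= y t ^+ 2 * sg t by rewrite mulr_ge0 ?sqr_ge0 // ltW.
  by lra.
have [|||C C0 HC] := @riccati_decay _ y (fun t => (2 * (1 + 2 * sg t))^-1)
  (Num.sqrt c) k k_gt0.
- move=> t; have g0 := sg_gt0 t; have gM := sg_le t.
  by rewrite /k lef_pV2 ?posrE; lra.
- by move=> t; rewrite -ltr_norml -sqrtr_sqr ltr_sqrt.
- by move=> t; rewrite sqr_sqrtr ?(ltW c0) //; exact: derive_logder.
exists (C / (8 * kappa)), (Num.sqrt c * k); split.
- by rewrite divr_ge0 // ltW.
- by rewrite mulr_gt0 // sqrtr_gt0.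
move=> t; rewrite mulrAC ler_pdivlMr // (mulrA 2).
have := HC t; rewrite sqr_sqrtr ?(ltW c0) //; apply: le_trans.
have ys := logder_sqr t.
have : 0 <= y t ^+ 2 * sg t by rewrite mulr_ge0 ?sqr_ge0 // ltW.
by lra.
Qed.

Lemma dist_decay : exists C n : R, [/\ 0 <= C, 0 < n &
  forall t, dist_to_set (phase A t) (Rset kappa X1bar X3bar) <=
    C * expR (- n * `|t|)].
Proof.
have [C [n [C0 n0 HC]]] := sg_decay.
have w0 : X3bar / 2 != 0 by exact: (angular_velocity_neq0 kappa_gt0).
pose D : R := 4 * (1 + (X3bar / 2) ^+ 2).
have D0 : 0 <= D by rewrite mulr_ge0 // addr_ge0 ?sqr_ge0.
exists (Num.sqrt (D * C)), n; split; rewrite ?sqrtr_ge0 // => t.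
apply: le_trans (dist_to_rotation_le X1barE w0 kappa_gt0 (WA t)) _.
rewrite -/D -(ger0_norm (expR_ge0 _)) -sqrtr_sqr.
rewrite -sqrtrM; last exact: mulr_ge0 D0 C0.
apply: ler_wsqrtr; rewrite -(mulrA D C) ler_wpM2l //; apply: le_trans (HC t) _.
rewrite ler_wpM2l // expr2 -expRD ler_expR le_eqVlt.
by apply/orP; left; apply/eqP; ring.
Qed.

(** Stated for every rate [k] below [n]: [k = 0] is plain convergence, a positive
    [k] exponential convergence. *)
Lemma homoclinic_decay : exists2 n : R, 0 < n & forall k : R, k < n ->
  expR (k * `|t|) * dist_to_set (phase A t) (Rset kappa X1bar X3bar)
    @[t --> +oo] --> (0 : R) /\
  expR (k * `|t|) * dist_to_set (phase A t) (Rset kappa X1bar X3bar)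
    @[t --> -oo] --> (0 : R).
Proof.
have [C [n [C0 n0 HC]]] := dist_decay; exists n => // k kn.
apply: (cvg0_expR_bound kn _ HC) => t.
exact: (dist_to_set_ge0 X1barE _ _ (angular_velocity_neq0 kappa_gt0 X3bar_gt)).
Qed.

End solution.

Theorem corollary11p4 (R : realType) (kappa X1bar X3bar : R)
    (kappa_gt0 : 0 < kappa)
    (X1barE : X1bar = kappa + X3bar ^+ 2 / 4)
    (X3bar_gt : 8 * kappa < X3bar ^+ 2) :
  let W := Wset kappa X1bar X3bar in
  let S := Rset kappa X1bar X3bar in
  let rot := fun t : R => Umx (X3bar / 2 * t) in
  [/\ is_rigid_rotation kappa rot,
      S = range (phase rot),
      stable_unstable_manifold kappa (W `\` S) S
    & forall A : R -> 'M[R]_2, is_solution kappa A ->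
        (forall t, (W `\` S) (phase A t)) -> homoclinic A S].
Proof.
move=> W S rot.
have w0 := angular_velocity_neq0 kappa_gt0 X3bar_gt.
(* invariance of the level set, and of the complement of the rotations *)
have away A : is_solution kappa A -> (W `\` S) (phase A 0) ->
    (forall t, W (phase A t)) /\ forall t, 0 < acre (A t) ^+ 2 + acim (A t) ^+ 2.
  move=> solA [W0 nS0].
  have WA := Wset_invariant solA X1barE W0; split=> // t.
  rewrite lt0r addr_ge0 ?sqr_ge0 // andbT; apply/eqP => sgt0; apply: nS0.
  apply/(Rset_sg solA WA).
  exact: (sg_dichotomy solA X1barE kappa_gt0 X3bar_gt WA sgt0).
split.
- exact: rigid_rotation.
- exact: (Rset_range X1barE w0).
- move=> A solA MA0; have [WA sg_gt0] := away A solA MA0.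
  have [n n0 lim] := homoclinic_decay solA X1barE kappa_gt0 X3bar_gt WA sg_gt0.
  have e0 : (fun t => expR (0 * `|t|) * dist_to_set (phase A t) S) =
      fun t => dist_to_set (phase A t) S.
    by apply/funext => t; rewrite mul0r expR0 mul1r.
  have [limp limm] := lim 0 n0.
  split; [|by rewrite -e0..].
  move=> t; split; first exact: WA.
  by move=> /(Rset_sg solA WA) sgt; have := sg_gt0 t; rewrite sgt ltxx.
- move=> A solA MA; have [WA sg_gt0] := away A solA (MA 0).
  have [n n0 lim] := homoclinic_decay solA X1barE kappa_gt0 X3bar_gt WA sg_gt0.
  by exists (n / 2); [lra | apply: lim; lra].
Qed.
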